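(* Let $W=W_{B_n}$ and let $M$ be a $(\mathcal C_{2n}\rtimes\mathbb C W)$-module. The action of $y_i$ on the $\mathbb H^{cc}_W$-module $\mathbb C[x_1,\dots,x_n]\otimes M$ is realized as the following Dunkl operator: for any $f\in\mathbb C[x_1,\dots,x_n]$ and $m\in M$, $$\begin{aligned}y_i\circ(f\otimes m)={}&tc_ie_i\frac{f-f^{\tau_i}}{2x_i}\otimes m-u\sum_{k\ne i}\left(\frac{f-f^{s_{ki}}}{x_i-x_k}+\frac{f-f^{\overline s_{ki}}}{x_i+x_k}c_kc_i\right)\otimes(1+e_ke_i)s_{ki}m\\&-u\sum_{k\ne i}\left(\frac{f-f^{\overline s_{ki}}}{x_i+x_k}-\frac{f-f^{s_{ki}}}{x_i-x_k}c_kc_i\right)\otimes(1-e_ke_i)\overline s_{ki}m-v\frac{f-f^{\tau_i}}{2x_i}\otimes\tau_im.\end{aligned}$$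
   Context: All algebras are over $\mathbb C$; $[x,y]=xy-yx$. $W_{B_n}$ is the group of signed permutations of $1,\dots,n$; $s_{ij}$ is the transposition of $i,j$, $\overline s_{ij}$ the transposition of $i,j$ coupled with sign changes at $i,j$, $\tau_i$ the sign change at $i$. $W$ acts on the span of symbols $a_1,\dots,a_n$ ($a=x,y,c,e$), $a_i\mapsto a_i^\sigma$: $s_{ij}$ swaps $a_i,a_j$; $\overline s_{ij}$ sends $a_i\mapsto-a_j$, $a_j\mapsto-a_i$; $\tau_i$ sends $a_i\mapsto-a_i$; other symbols are fixed. $f\mapsto f^\sigma$ is the induced action on polynomials in $x_1,\dots,x_n$. $\mathcal C_{2n}$ is the Clifford algebra generated by pairwise anticommuting $c_1,\dots,c_n,e_1,\dots,e_n$ of square $1$; $\mathcal C_{2n}\rtimes\mathbb C W$ is the smash product ($\sigma c_i=c_i^\sigma\sigma$, $\sigma e_i=e_i^\sigma\sigma$). Let $t,u,v\in\mathbb C$. $\mathbb H^{cc}_W$ (type $B_n$) is generated by $x_i,y_i$ ($1\le i\le n$), $\mathcal C_{2n}$ and $W$ subject to, for all $i,j$, $\sigma\in W$: $x_ix_j=x_jx_i$, $y_iy_j=y_jy_i$, $\sigma a_i=a_i^\sigma\sigma$ for $a=c,e,x,y$, $e_ix_j=x_je_i$, $c_ix_j=(-1)^{\delta_{ij}}x_jc_i$, $c_iy_j=y_jc_i$, $e_iy_j=(-1)^{\delta_{ij}}y_je_i$, and $[y_i,x_j]=u(1+c_ic_j)(1+e_je_i)s_{ij}-u(1-c_ic_j)(1-e_je_i)\overline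 s_{ij}$ ($i\ne j$), $[y_i,x_i]=tc_ie_i-u\sum_{k\ne i}(1+c_kc_i)(1+e_ke_i)s_{ki}-u\sum_{k\ne i}(1-c_kc_i)(1-e_ke_i)\overline s_{ki}-v\tau_i$. The module: let $\mathfrak H_y\subset\mathbb H^{cc}_W$ be the subalgebra generated by $\mathcal C_{2n}\rtimes\mathbb C W$ and $y_1,\dots,y_n$. Extend $M$ to an $\mathfrak H_y$-module by letting each $y_i$ act by $0$, and form the induced module $\mathrm{Ind}_{\mathfrak H_y}^{\mathbb H^{cc}_W}M$, identified as a vector space with $\mathbb C[x_1,\dots,x_n]\otimes M$ ($f\otimes m$ corresponding to $f\cdot m$). Conventions in the formula: products of polynomials and elements of $\mathcal C_{2n}$ are taken using the relations of $\mathbb H^{cc}_W$, and for a polynomial $p$ and $b\in\mathcal C_{2n}$ one sets $pb\otimes m=p\otimes bm$. *)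

(* Defs.v *)
From HB Require Import structures.
From mathcomp Require Import all_boot all_order all_fingroup all_algebra.
From mathcomp Require Import generic_quotient ring_quotient.
From mathcomp Require Import boolp classical_sets.
From mathcomp Require Import finmap monalg.

Set Implicit Arguments.
Unset Strict Implicit.
Unset Printing Implicit Defensive.

Import GRing.Theory.
Local Open Scope ring_scope.
Local Open Scope quotient_scope.

Section AdditiveSpan.
Variables (V : zmodType) (G : V -> Prop).

Inductive in_zspan : V -> Prop :=
| zspan_gen z : G z -> in_zspan z
| zspan_0 : in_zspan 0
| zspan_sub a b : in_zspan a -> in_zspan b -> in_zspan (a - b).

Definition zspan : {pred V} := fun z => `[< in_zspan z >].

Lemma zspanP z : reflect (in_zspan z) (z \in zspan).
Proof. exact: asboolP. Qed.

Lemma zspan_zmod_closed : zmod_closed zspan.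
Proof.
split=> [|a b /zspanP Ha /zspanP Hb]; apply/zspanP; [exact: zspan_0|].
exact: zspan_sub.
Qed.

HB.instance Definition _ := GRing.isZmodClosed.Build V zspan zspan_zmod_closed.

Lemma zspan_additive (f : V -> V) :
    (forall a b, f (a - b) = f a - f b) ->
    (forall z, G z -> f z \in zspan) ->
  forall z, z \in zspan -> f z \in zspan.
Proof.
move=> fB fG z /zspanP; elim=> {z} [z /fG //||a b _ Ha _ Hb].
  by rewrite -(subrr 0) fB subrr rpred0.
by rewrite fB rpredB.
Qed.

Definition zquot : Type := {ideal_quot zspan}.
HB.instance Definition _ := GRing.Zmodule.on zquot.

Definition zpi (a : V) : zquot := \pi_({ideal_quot zspan}) a.
Definition zrepr (q : zquot) : V := repr q.

Lemma zpiP a b : zpi a = zpi b <-> a - b \in zspan.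
Proof. by rewrite Quotient.idealrBE; split=> [E|/eqP]; first exact/eqP. Qed.

Lemma zreprK q : zpi (zrepr q) = q.
Proof. exact: reprK. Qed.

Lemma zpiB a b : zpi (a - b) = zpi a - zpi b.
Proof. exact: raddfB. Qed.

Lemma zpiD a b : zpi (a + b) = zpi a + zpi b.
Proof. exact: raddfD. Qed.

End AdditiveSpan.

(* The quotient of an algebra by the two-sided ideal generated by the          *)
(* differences a - b with rel a b. It may be the zero ring, hence pzRingType.  *)
Section AlgebraQuotient.
Variables (K : comNzRingType) (F : lalgType K) (rel : F -> F -> Prop).

Definition ideal_gen (z : F) : Prop :=
  exists a r1 r2 b, rel r1 r2 /\ z = a * (r1 - r2) * b.

Definition algquot : Type := zquot ideal_gen.
HB.instance Definition _ := GRing.Zmodule.on algquot.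

Definition alg_pi (a : F) : algquot := zpi ideal_gen a.
Local Notation repr := (@zrepr _ ideal_gen).

Lemma alg_piE a b : alg_pi a = alg_pi b <-> a - b \in zspan ideal_gen.
Proof. exact: zpiP. Qed.

Lemma alg_pi_repr (q : algquot) : alg_pi (repr q) = q.
Proof. exact: zreprK. Qed.

Lemma alg_piB a b : alg_pi (a - b) = alg_pi a - alg_pi b.
Proof. exact: zpiB. Qed.

Lemma alg_piD a b : alg_pi (a + b) = alg_pi a + alg_pi b.
Proof. exact: zpiD. Qed.

Lemma alg_pi_ind (P : algquot -> Prop) : (forall a, P (alg_pi a)) -> forall q, P q.
Proof. by move=> H q; rewrite -(alg_pi_repr q). Qed.

Lemma ideal_mull a z : z \in zspan ideal_gen -> a * z \in zspan ideal_gen.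
Proof.
apply: zspan_additive => [x y|x [c [r1 [r2 [b [r12 ->]]]]]]; first by rewrite mulrBr.
by apply/zspanP/zspan_gen; exists (a * c), r1, r2, b; rewrite !mulrA.
Qed.

Lemma ideal_mulr a z : z \in zspan ideal_gen -> z * a \in zspan ideal_gen.
Proof.
apply: (@zspan_additive _ _ (fun w => w * a)) => [x y|x [c [r1 [r2 [b [r12 ->]]]]]].
  by rewrite mulrBl.
by apply/zspanP/zspan_gen; exists c, r1, r2, (b * a); rewrite !mulrA.
Qed.

Definition aq_one : algquot := alg_pi 1.
Definition aq_mul (p q : algquot) : algquot := alg_pi (repr p * repr q).
Definition aq_scale (k : K) (q : algquot) : algquot := alg_pi (k *: repr q).

Lemma repr_piB a : repr (alg_pi a) - a \in zspan ideal_gen.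
Proof. by apply/alg_piE; rewrite alg_pi_repr. Qed.

Lemma aq_mulE a b : aq_mul (alg_pi a) (alg_pi b) = alg_pi (a * b).
Proof.
apply/alg_piE.
rewrite -(subrK (a * repr (alg_pi b)) (_ * _)) -mulrBl -addrA -mulrBr.
by apply: rpredD; [apply: ideal_mulr|apply: ideal_mull]; exact: repr_piB.
Qed.

Lemma aq_scaleE k a : aq_scale k (alg_pi a) = alg_pi (k *: a).
Proof.
apply/alg_piE; rewrite -scalerBr -[_ - a]mul1r scalerAl.
by apply: ideal_mull; exact: repr_piB.
Qed.

Fact aq_mulA : associative aq_mul.
Proof.
move=> p q r; elim/alg_pi_ind: p => a; elim/alg_pi_ind: q => b.
elim/alg_pi_ind: r => c.
by rewrite !aq_mulE mulrA.
Qed.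

Fact aq_mul1 : left_id aq_one aq_mul.
Proof. by move=> p; elim/alg_pi_ind: p => a; rewrite aq_mulE mul1r. Qed.

Fact aq_mulr1 : right_id aq_one aq_mul.
Proof. by move=> p; elim/alg_pi_ind: p => a; rewrite aq_mulE mulr1. Qed.

Fact aq_mulDl : left_distributive aq_mul +%R.
Proof.
move=> p q r; elim/alg_pi_ind: p => a; elim/alg_pi_ind: q => b.
elim/alg_pi_ind: r => c.
by rewrite -alg_piD !aq_mulE mulrDl alg_piD.
Qed.

Fact aq_mulDr : right_distributive aq_mul +%R.
Proof.
move=> p q r; elim/alg_pi_ind: p => a; elim/alg_pi_ind: q => b.
elim/alg_pi_ind: r => c.
by rewrite -alg_piD !aq_mulE mulrDr alg_piD.
Qed.

HB.instance Definition _ := GRing.Zmodule_isPzRing.Build algquot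
  aq_mulA aq_mul1 aq_mulr1 aq_mulDl aq_mulDr.

Fact aq_scaleA a b q : aq_scale a (aq_scale b q) = aq_scale (a * b) q.
Proof. by elim/alg_pi_ind: q => q; rewrite !aq_scaleE scalerA. Qed.

Fact aq_scale1 : left_id 1 aq_scale.
Proof. by move=> p; elim/alg_pi_ind: p => q; rewrite aq_scaleE scale1r. Qed.

Fact aq_scaleDr : right_distributive aq_scale +%R.
Proof.
move=> k p q; elim/alg_pi_ind: p => a; elim/alg_pi_ind: q => b.
by rewrite -alg_piD !aq_scaleE scalerDr alg_piD.
Qed.

Fact aq_scaleDl q : {morph aq_scale^~ q : a b / a + b}.
Proof.
by move=> a b; elim/alg_pi_ind: q => q; rewrite !aq_scaleE scalerDl alg_piD.
Qed.

HB.instance Definition _ := GRing.Zmodule_isLmodule.Build K algquot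
  aq_scaleA aq_scale1 aq_scaleDr aq_scaleDl.

Lemma alg_piM a b : alg_pi (a * b) = alg_pi a * alg_pi b.
Proof. by rewrite -aq_mulE. Qed.

Lemma alg_pi1 : alg_pi 1 = 1. Proof. by []. Qed.

Lemma alg_piZ k a : alg_pi (k *: a) = k *: alg_pi a.
Proof. by rewrite -aq_scaleE. Qed.

Lemma alg_pi_rel a b : rel a b -> alg_pi a = alg_pi b.
Proof.
move=> ab; apply/alg_piE/zspanP/zspan_gen.
by exists 1, a, b, 1; rewrite mul1r mulr1.
Qed.

End AlgebraQuotient.

Definition freealg (K : comNzRingType) (X : choiceType) : lalgType K :=
  {malg K[{fmonom X}]}.

Definition freegen (K : comNzRingType) (X : choiceType) (g : X) : freealg K X :=
  mkmalgU (fmu g) 1.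

Section GeneratedSubalgebra.
Variables (K : comNzRingType) (F : lalgType K) (rel : F -> F -> Prop).
Local Notation A := (algquot rel).
Variable G : A -> Prop.

Inductive in_subalg : A -> Prop :=
| subalg_gen a : G a -> in_subalg a
| subalg_1 : in_subalg 1
| subalg_sub a b : in_subalg a -> in_subalg b -> in_subalg (a - b)
| subalg_mul a b : in_subalg a -> in_subalg b -> in_subalg (a * b)
| subalg_scale k a : in_subalg a -> in_subalg (k *: a).

Definition subalg : {pred A} := fun a => `[< in_subalg a >].

Lemma subalgP a : reflect (in_subalg a) (a \in subalg).
Proof. exact: asboolP. Qed.

Lemma subalg_subring_closed : subring_closed subalg.
Proof.
split; first exact/subalgP/subalg_1.
  by move=> a b /subalgP Ha /subalgP Hb; apply/subalgP/subalg_sub.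
by move=> a b /subalgP Ha /subalgP Hb; apply/subalgP/subalg_mul.
Qed.

Record subalg_type : Type :=
  SubalgType { subalg_val : A; subalg_valP : subalg_val \in subalg }.

HB.instance Definition _ := [isSub for subalg_val].
HB.instance Definition _ := [Choice of subalg_type by <:].
HB.instance Definition _ := GRing.SubChoice_isSubPzRing.Build A subalg subalg_type subalg_subring_closed.

Definition in_subalg_type (a : A) (Ha : in_subalg a) : subalg_type :=
  SubalgType (introT (subalgP a) Ha).

End GeneratedSubalgebra.

Definition left_action (S : pzRingType) (M : zmodType) (act : S -> M -> M) :=
  [/\ forall m, act 1 m = m,
      forall a b m, act (a * b) m = act a (act b m),
      forall a b m, act (a + b) m = act a m + act b m
    & forall a m m', act a (m + m') = act a m + act a m'].

(* H (x)_S M for a left S-module (M, act) and a ring S mapped to H by emb, as  *)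
(* the free abelian group on H * M modulo the usual balancing relations, with  *)
(* its left H-module structure.                                                *)
Section InducedModule.
Variables (H S : pzRingType) (emb : S -> H) (M : zmodType) (act : S -> M -> M).

Local Notation V := {malg int[(H * M)%type]}.

Definition sym (h : H) (m : M) : V := mkmalgU (h, m) 1.

Variant balanced : V -> Prop :=
| bal_addl h h' m : balanced (sym (h + h') m - (sym h m + sym h' m))
| bal_addr h m m' : balanced (sym h (m + m') - (sym h m + sym h m'))
| bal_act h b m : balanced (sym (h * emb b) m - sym h (act b m)).

Definition Ind : Type := zquot balanced.
Local Notation pi := (zpi balanced).
Local Notation repr := (@zrepr _ balanced).

HB.instance Definition _ := GRing.Zmodule.on Ind.

Definition tens (h : H) (m : M) : Ind := pi (sym h m).

Definition lmulV (h : H) (z : V) : V :=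
  \sum_(p <- msupp z) mkmalgU (h * p.1, p.2) z@_p.

Lemma lmulVEw h (d : {fset (H * M)%type}) z : (msupp z `<=` d)%fset ->
  lmulV h z = \sum_(p <- d) mkmalgU (h * p.1, p.2) z@_p.
Proof.
move=> le; rewrite /lmulV (big_fset_incl _ le) //= => p pd /mcoeff_outdom ->.
by rewrite monalgU0.
Qed.

Lemma lmulVB h : {morph lmulV h : a b / a - b}.
Proof.
move=> a b; pose d := (msupp a `|` msupp b)%fset.
have da : (msupp a `<=` d)%fset by rewrite fsubsetUl.
have db : (msupp b `<=` d)%fset by rewrite fsubsetUr.
have dab : (msupp (a - b) `<=` d)%fset.
  apply/fsubsetP=> p; rewrite -mcoeff_neq0 mcoeffB in_fsetU -!mcoeff_neq0.
  by apply: contraR; rewrite negb_or !negbK => /andP[/eqP-> /eqP->]; rewrite subr0.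
rewrite (lmulVEw _ da) (lmulVEw _ db) (lmulVEw _ dab) -sumrB.
by apply: eq_bigr => p _; rewrite mcoeffB monalgUB.
Qed.

Lemma lmulV_sym h k m : lmulV h (sym k m) = sym (h * k) m.
Proof.
by rewrite (lmulVEw _ (msuppU_le)) big_seq_fset1 mcoeffUU.
Qed.

Lemma lmulVD h : {morph lmulV h : a b / a + b}.
Proof.
have l0 : lmulV h 0 = 0 by have := lmulVB h 0 0; rewrite !subrr.
have lN a : lmulV h (- a) = - lmulV h a by rewrite -[- a]add0r lmulVB l0 sub0r.
by move=> a b; have := lmulVB h a (- b); rewrite lN !opprK.
Qed.

Lemma lmulV_balanced h z : z \in zspan balanced -> lmulV h z \in zspan balanced.
Proof.
apply: zspan_additive; first exact: lmulVB.
move=> {}z; case=> *; rewrite lmulVB ?lmulVD !lmulV_sym; apply/zspanP/zspan_gen.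
- by rewrite mulrDr; exact: bal_addl.
- exact: bal_addr.
- by rewrite mulrA; exact: bal_act.
Qed.

Definition ind_scale (h : H) (w : Ind) : Ind := pi (lmulV h (repr w)).

Lemma ind_piE (a b : V) : pi a = pi b <-> a - b \in zspan balanced.
Proof. exact: zpiP. Qed.

Lemma ind_scale_pi h z : ind_scale h (pi z) = pi (lmulV h z).
Proof.
by apply/ind_piE; rewrite -lmulVB lmulV_balanced //; apply/ind_piE; rewrite zreprK.
Qed.

Lemma V_ind (P : V -> Prop) :
    P 0 -> (forall a b, P a -> P b -> P (a - b)) -> (forall h m, P (sym h m)) ->
  forall z, P z.
Proof.
move=> P0 PB Ps z.
have PN a : P a -> P (- a) by rewrite -[- a]add0r; exact: PB.
have PD a b : P a -> P b -> P (a + b) by move=> Pa /PN Pb; rewrite -[b]opprK; exact: PB.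
have PU p (k : int) : P (mkmalgU p k).
  have PUn n : P (mkmalgU p n%:Z).
    elim: n => [|n IH]; first by rewrite monalgU0.
    by rewrite intS monalgUD; apply: PD => //; case: p {IH} => h m; exact: Ps.
  by case: (intP k) => [|n|n]; rewrite ?monalgUN; [exact: (PUn 0)|exact: PUn|exact/PN/PUn].
by rewrite (monalgE z); elim/big_ind: _ => // p _; exact: PU.
Qed.

Lemma Ind_ind (P : Ind -> Prop) :
    P 0 -> (forall a b, P a -> P b -> P (a - b)) -> (forall h m, P (tens h m)) ->
  forall w, P w.
Proof.
move=> P0 PB Pt w; rewrite -[w]zreprK.
elim/V_ind: (repr w) => [|a b Pa Pb|h m]; last exact: Pt.
  by have := zpiB balanced 0 0; rewrite !subrr => ->.
by rewrite zpiB; exact: PB.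
Qed.

Lemma ind_scaleB h : {morph ind_scale h : a b / a - b}.
Proof.
by move=> a b; rewrite -[a]zreprK -[b]zreprK -zpiB !ind_scale_pi lmulVB zpiB.
Qed.

Fact ind_scaleDr : right_distributive ind_scale +%R.
Proof.
by move=> h a b; rewrite -[a]zreprK -[b]zreprK -zpiD !ind_scale_pi lmulVD zpiD.
Qed.

Lemma ind_scale0 h : ind_scale h 0 = 0.
Proof. by have := ind_scaleB h 0 0; rewrite !subrr. Qed.

Lemma ind_scale_tens h k m : ind_scale h (tens k m) = tens (h * k) m.
Proof. by rewrite ind_scale_pi lmulV_sym. Qed.

Lemma tensDl h h' m : tens (h + h') m = tens h m + tens h' m.
Proof.
by rewrite /tens -zpiD; apply/ind_piE/zspanP/zspan_gen; exact: bal_addl.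
Qed.

Lemma tensDr h m m' : tens h (m + m') = tens h m + tens h m'.
Proof.
by rewrite /tens -zpiD; apply/ind_piE/zspanP/zspan_gen; exact: bal_addr.
Qed.

Lemma tens_act h b m : tens (h * emb b) m = tens h (act b m).
Proof. by apply/ind_piE/zspanP/zspan_gen; exact: bal_act. Qed.

Fact ind_scaleA h k w : ind_scale h (ind_scale k w) = ind_scale (h * k) w.
Proof.
elim/Ind_ind: w => [|a b IHa IHb|l m]; first by rewrite !ind_scale0.
  by rewrite !ind_scaleB IHa IHb.
by rewrite !ind_scale_tens mulrA.
Qed.

Fact ind_scale1 : left_id 1 ind_scale.
Proof.
move=> w; elim/Ind_ind: w => [|a b IHa IHb|l m]; first by rewrite ind_scale0.
  by rewrite ind_scaleB IHa IHb.
by rewrite ind_scale_tens mul1r.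
Qed.

Fact ind_scaleDl w : {morph ind_scale^~ w : h k / h + k}.
Proof.
move=> h k; elim/Ind_ind: w => [|a b IHa IHb|l m].
- by rewrite !ind_scale0 addr0.
- by rewrite !ind_scaleB IHa IHb opprD addrACA.
- by rewrite !ind_scale_tens mulrDl tensDl.
Qed.

HB.instance Definition _ := GRing.Zmodule_isLmodule.Build H Ind
  ind_scaleA ind_scale1 ind_scaleDr ind_scaleDl.

Lemma scale_tens h k m : h *: tens k m = tens (h * k) m.
Proof. exact: ind_scale_tens. Qed.

End InducedModule.

Section SignedPermutations.
Variable n : nat.

(* (i, false) stands for i and (i, true) for - i.                              *)
Definition signed : finType := ('I_n * bool)%type.

Definition sflip (p : signed) : signed := (p.1, ~~ p.2).

Lemma sflip_inj : injective sflip.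
Proof. by move=> [i b] [j c] [-> /negb_inj ->]. Qed.

Definition WB : {group {perm signed}} := ('C[perm sflip_inj])%G.

Definition W := subg_of WB.
HB.instance Definition _ := Finite.on W.
HB.instance Definition _ := FinGroup.on W.

Definition sperm_fun (pi : {perm 'I_n}) (eps : pred 'I_n) (p : signed) : signed :=
  (pi p.1, p.2 (+) eps p.1).

Lemma sperm_inj pi eps : injective (sperm_fun pi eps).
Proof. by move=> [i b] [j c] [/perm_inj <- /addIb ->]. Qed.

Lemma sperm_WB pi eps : perm (@sperm_inj pi eps) \in WB.
Proof.
by apply/cent1P/permP=> -[i b]; rewrite !permM !permE /sflip /sperm_fun /= addNb.
Qed.

(* i |-> pi i, with a change of sign when eps i.                               *)
Definition sperm pi eps : W := Subg (sperm_WB pi eps).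

Definition s_ (i j : 'I_n) : W := sperm (tperm i j) pred0.
Definition sbar (i j : 'I_n) : W := sperm (tperm i j) (pred2 i j).
Definition tau (i : 'I_n) : W := sperm 1 (pred1 i).

(* Permutations compose from left to right in fingroup.                        *)
Definition wcomp (sg sg' : W) : W := (sg' * sg)%g.

(* a_i ^ sigma for symbols a_1, ..., a_n interpreted in V.                     *)
Definition wact (V : zmodType) (a : 'I_n -> V) (sg : W) (i : 'I_n) : V :=
  let p := sgval sg (i, false) in if p.2 then - a p.1 else a p.1.

Lemma wact_s (V : zmodType) (a : 'I_n -> V) i j k :
  wact a (s_ i j) k = a (tperm i j k).
Proof. by rewrite /wact /= permE. Qed.

Lemma wact_sbar (V : zmodType) (a : 'I_n -> V) i j k :
  wact a (sbar i j) k =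
  if (k == i) || (k == j) then - a (tperm i j k) else a k.
Proof.
rewrite /wact /= permE /=; case: ifP => //= /norP[ki kj].
by rewrite tpermD // eq_sym.
Qed.

Lemma wact_tau (V : zmodType) (a : 'I_n -> V) i k :
  wact a (tau i) k = if k == i then - a k else a k.
Proof. by rewrite /wact /= permE /= perm1. Qed.

Lemma wact_comp (V : zmodType) (a : 'I_n -> V) (sg sg' : W) i :
  wact a (wcomp sg sg') i = wact (wact a sg) sg' i.
Proof.
have flipE p : sgval sg (sflip p) = sflip (sgval sg p).
  have /cent1P/permP/(_ p) : sgval sg \in WB := subgP sg.
  by rewrite !permM !permE.
rewrite /wact /= permM; case: (sgval sg' (i, false)) => j [] //=.
rewrite -[(j, true)]/(sflip (j, false)) flipE.
by case: (sgval sg (j, false)) => k [] /=; rewrite ?opprK.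
Qed.

End SignedPermutations.

From mathcomp Require Import mpoly.

(* monalg uses the same notation for another type.                             *)
Local Notation "{ 'mpoly' T [ n ] }" := (mpoly n T) : type_scope.

Section Algebras.
Variables (K : comNzRingType) (n : nat).
Local Notation W := (W n).

(* A presentation of C_2n >| CW, with one generator w sigma for each sigma in  *)
(* W; it is stated in any A because it is also part of the presentation of Hcc. *)
Variant smash_relations (A : pzRingType) (c e : 'I_n -> A) (w : W -> A) :
    A -> A -> Prop :=
| sm_cc i : smash_relations c e w (c i * c i) 1
| sm_ee i : smash_relations c e w (e i * e i) 1
| sm_cC i j : i != j -> smash_relations c e w (c i * c j) (- (c j * c i))
| sm_eC i j : i != j -> smash_relations c e w (e i * e j) (- (e j * e i))
| sm_ce i j : smash_relations c e w (c i * e j) (- (e j * c i))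
| sm_w1 : smash_relations c e w (w 1%g) 1
| sm_wM sg sg' : smash_relations c e w (w sg * w sg') (w (wcomp sg sg'))
| sm_wc sg i : smash_relations c e w (w sg * c i) (wact c sg i * w sg)
| sm_we sg i : smash_relations c e w (w sg * e i) (wact e sg i * w sg).

Section Smash.

Let X : choiceType := ('I_n + 'I_n + W)%type.
Let gc i : freealg K X := freegen K (inl (inl i)).
Let ge i : freealg K X := freegen K (inl (inr i)).
Let gw sg : freealg K X := freegen K (inr sg).

Definition smash := algquot (smash_relations gc ge gw).
HB.instance Definition _ := GRing.PzRing.on smash.
HB.instance Definition _ := GRing.Lmodule.on smash.

Definition sc i : smash := alg_pi _ (gc i).
Definition se i : smash := alg_pi _ (ge i).
Definition sw sg : smash := alg_pi _ (gw sg).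

End Smash.

Section Hcc.
Variables t u v : K.

Section Relations.
Variables (A : lalgType K) (x y c e : 'I_n -> A) (w : W -> A).

Let comm_xy (i j : 'I_n) : A := y i * x j - x j * y i.

Variant Hcc_relations : A -> A -> Prop :=
| H_smash a b : smash_relations c e w a b -> Hcc_relations a b
| H_xx i j : Hcc_relations (x i * x j) (x j * x i)
| H_yy i j : Hcc_relations (y i * y j) (y j * y i)
| H_wx sg i : Hcc_relations (w sg * x i) (wact x sg i * w sg)
| H_wy sg i : Hcc_relations (w sg * y i) (wact y sg i * w sg)
| H_ex i j : Hcc_relations (e i * x j) (x j * e i)
| H_cx i j : Hcc_relations (c i * x j) ((-1) ^+ (i == j) * (x j * c i))
| H_cy i j : Hcc_relations (c i * y j) (y j * c i)
| H_ey i j : Hcc_relations (e i * y j) ((-1) ^+ (i == j) * (y j * e i))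
| H_yx i j : i != j -> Hcc_relations (comm_xy i j)
    (u *: ((1 + c i * c j) * (1 + e j * e i) * w (s_ i j))
     - u *: ((1 - c i * c j) * (1 - e j * e i) * w (sbar i j)))
| H_yx_diag i : Hcc_relations (comm_xy i i)
    (t *: (c i * e i)
     - u *: (\sum_(k < n | k != i)
               (1 + c k * c i) * (1 + e k * e i) * w (s_ k i))
     - u *: (\sum_(k < n | k != i)
               (1 - c k * c i) * (1 - e k * e i) * w (sbar k i))
     - v *: w (tau i)).

End Relations.

Let X : choiceType := ('I_n + 'I_n + ('I_n + 'I_n) + W)%type.
Let gx i : freealg K X := freegen K (inl (inl (inl i))).
Let gy i : freealg K X := freegen K (inl (inl (inr i))).
Let gc i : freealg K X := freegen K (inl (inr (inl i))).
Let ge i : freealg K X := freegen K (inl (inr (inr i))).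
Let gw sg : freealg K X := freegen K (inr sg).

Definition Hcc := algquot (Hcc_relations gx gy gc ge gw).
HB.instance Definition _ := GRing.PzRing.on Hcc.
HB.instance Definition _ := GRing.Lmodule.on Hcc.

Definition hx i : Hcc := alg_pi _ (gx i).
Definition hy i : Hcc := alg_pi _ (gy i).
Definition hc i : Hcc := alg_pi _ (gc i).
Definition he i : Hcc := alg_pi _ (ge i).
Definition hw sg : Hcc := alg_pi _ (gw sg).

Definition hcst (k : K) : Hcc := k *: (1 : Hcc).

Definition pol (f : {mpoly K[n]}) : Hcc :=
  \sum_(a <- msupp f) f@_a *: \prod_(k < n) hx k ^+ a k.

Variant Hy_gen : Hcc -> Prop :=
| Hy_c i : Hy_gen (hc i)
| Hy_e i : Hy_gen (he i)
| Hy_w sg : Hy_gen (hw sg)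
| Hy_y i : Hy_gen (hy i).

Definition Hy := subalg_type Hy_gen.
HB.instance Definition _ := GRing.PzRing.on Hy.

Definition Hy_val : Hy -> Hcc := @subalg_val _ _ _ _.

Definition yc i : Hy := in_subalg_type (subalg_gen (Hy_c i)).
Definition ye i : Hy := in_subalg_type (subalg_gen (Hy_e i)).
Definition yw sg : Hy := in_subalg_type (subalg_gen (Hy_w sg)).
Definition yy i : Hy := in_subalg_type (subalg_gen (Hy_y i)).
Definition ycst (k : K) : Hy :=
  in_subalg_type (subalg_scale k (subalg_1 Hy_gen)).

(* act is the extension of the smash-module M to a module over Hy on which     *)
(* the y_i act by 0; smash is generated as a ring by the scalars, c_i, e_i, W. *)
Definition extends_by_zero (M : lmodType smash) (act : Hy -> M -> M) : Prop :=
  left_action act /\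
  forall m : M,
    [/\ forall k, act (ycst k) m = (k *: (1 : smash)) *: m,
        forall i, act (yc i) m = sc i *: m,
        forall i, act (ye i) m = se i *: m,
        forall sg, act (yw sg) m = sw sg *: m
      & forall i, act (yy i) m = 0].

(* Under C[x] (x) M = IndM act, the vector f (x) m is tensM act (pol f) m, and *)
(* p b (x) m = p (x) b m, for b in C_2n, is the balancing relation tens_act.   *)
Definition IndM (M : lmodType smash) (act : Hy -> M -> M) := Ind Hy_val act.

Definition tensM (M : lmodType smash) (act : Hy -> M -> M) (h : Hcc) (m : M) :
  IndM act := tens Hy_val act h m.

HB.instance Definition _ (M : lmodType smash) (act : Hy -> M -> M) :=
  GRing.Lmodule.on (IndM act).

End Hcc.

Definition polact (f : {mpoly K[n]}) (sg : W) : {mpoly K[n]} :=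
  f \mPo [tuple wact (fun k => 'X_k) sg j | j < n].

(* The exact quotient p / d of polynomials: the q with q * d = p, if any.      *)
Definition exquo (p d : {mpoly K[n]}) : {mpoly K[n]} :=
  xget 0 [set q | q * d = p]%classic.

End Algebras.

Arguments sc {K n} i.
Arguments se {K n} i.
Arguments sw {K n} sg.
Arguments pol {K n} t u v f.
Arguments hcst {K n} t u v k.

(* Main.v *)
Require Import Defs.
From HB Require Import structures.
From mathcomp Require Import all_boot all_order all_fingroup all_algebra.
From mathcomp Require Import reals complex mpoly ssrcomplements.
From mathcomp Require classical_sets monalg.

Set Implicit Arguments.
Unset Strict Implicit.
Unset Printing Implicit Defensive.

Import GRing.Theory.
Local Open Scope ring_scope.

(** In the induced module [y_i] kills [1 (x) M], so
    [y_i (f (x) m) = [y_i, f] (x) m] and the theorem computes the commutator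
    [[y_i, f]] in the algebra. Both sides of the claimed formula are additive
    in [f], vanish on constants and, on [f = x_j], agree with the defining
    relation for [[y_i, x_j]]. They also obey the same Leibniz rule under
    [f |-> x_j f]. On the left, [[y_i, x_j f] = x_j [y_i, f] + [y_i, x_j] f].
    On the right, each divided difference [D f = (f - f^s) / d] satisfies the
    twisted rule [D (x_j f) = x_j D f + ((x_j - x_j^s) / d) f^s]
    ([quotient_twisted_leibniz]), where the quotient [(x_j - x_j^s) / d] is
    [0], [1] or [-1].

    The two rules match because group elements and Clifford elements move
    across polynomials in a compatible way: [w(sigma) f = f^sigma w(sigma)],
    the [e_i] commute with polynomials, and [c_k c_i], which changes the sign
    of [x_k] and [x_i], exchanges [f^s] and [f^sbar] for [s = s_ki] and
    [sbar = sbar_ki] ([cc_pol_s], [cc_pol_sbar]). Pushing [f] to the left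
    through the Clifford and group factors of [[y_i, x_j]] therefore produces
    exactly the correction terms of the twisted rule ([y_x_pol]).

    The induction ([y_pol]) carries the quotients as unknowns that satisfy
    their defining equations, which proves their existence along the way;
    the polynomials form a domain, so these unknowns are the exact quotients
    ([dunkl_sum_exquo]). The commutator formula holds for any
    elements of any ring that satisfy the relations used above; it is then
    specialized to the algebra itself ([Hcc_y_pol]) and carried to the induced
    module ([y_tens]). *)

(** * Scalars of quotient algebras *)

(** Scalars are central in the free algebra because they are the multiples of
    the empty word. *)
Lemma freealg_scaleAr (K : comNzRingType) (X : choiceType) (k : K)
    (a b : freealg K X) : a * (k *: b) = k *: (a * b).
Proof.
have central (g : freealg K X) : g * (k *: 1) = k *: g.
  rewrite -!monalg.mul_malgC mulr1 !monalg.malgM_def.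
  rewrite monalg.fgmulgU monalg.fgmulUg.
  by apply: eq_bigr => l _; rewrite monalg.mulm1 monalg.mul1m mulrC.
have -> : k *: b = (k *: 1) * b by rewrite -scalerAl mul1r.
by rewrite mulrA central -scalerAl.
Qed.

Lemma alg_pi0 (K : comNzRingType) (F : lalgType K) (rel : F -> F -> Prop) :
  alg_pi rel 0 = 0.
Proof. by have := alg_piB rel 0 0; rewrite !subrr. Qed.

Lemma alg_piN (K : comNzRingType) (F : lalgType K) (rel : F -> F -> Prop) a :
  alg_pi rel (- a) = - alg_pi rel a.
Proof. by rewrite -[in LHS]sub0r alg_piB alg_pi0 sub0r. Qed.

(** * Polynomials and the action of signed permutations *)

Section PolynomialInduction.
Variables (K : comNzRingType) (n : nat).

(** The induction principle behind every computation below: a statement about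
    polynomials that is additive and holds for constants need only be
    propagated along multiplication by one variable. *)
Lemma mpoly_generators_ind (P : {mpoly K[n]} -> Prop) :
    (forall k, P k%:MP) -> (forall f g, P f -> P g -> P (f + g)) ->
    (forall j f, P f -> P ('X_j * f)) -> forall f, P f.
Proof.
move=> PC PD PX; elim/mpolyind=> [|k m f _ _ Pf]; first by rewrite -mpolyC0.
apply: PD Pf; rewrite -mul_mpolyC mulrC.
suff Q g : P g -> P ('X_[m] * g) by exact: Q.
rewrite mpolyXE_id; move: g.
elim/big_ind: _ => [g|p q IHp IHq g Pg|j _ g Pg]; first by rewrite mul1r.
  by rewrite -mulrA; apply/IHp/IHq.
by elim: (m j) => [|d IH]; rewrite ?expr0 ?mul1r // exprS -mulrA; exact: PX.
Qed.

Lemma polactD (f g : {mpoly K[n]}) sg :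
  polact (f + g) sg = polact f sg + polact g sg.
Proof. exact: comp_mpolyD. Qed.

Lemma polactC (k : K) (sg : W n) : polact k%:MP sg = k%:MP.
Proof. exact: comp_mpolyC. Qed.

Lemma polactXM j (f : {mpoly K[n]}) sg :
  polact ('X_j * f) sg = wact (fun l => 'X_l) sg j * polact f sg.
Proof.
by rewrite /polact rmorphM /= {1}/comp_mpoly mmapX mmap1U tnth_mktuple.
Qed.

Lemma wact1 (V : zmodType) (a : 'I_n -> V) j : wact a 1%g j = a j.
Proof. by rewrite /wact /= perm1. Qed.

Lemma polact1 (f : {mpoly K[n]}) : polact f 1%g = f.
Proof.
rewrite /polact -[RHS]comp_mpoly_id; congr (_ \mPo _).
by apply: eq_from_tnth => j; rewrite !tnth_mktuple wact1.
Qed.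

End PolynomialInduction.

Lemma s_C n (i j : 'I_n) : s_ i j = s_ j i.
Proof. by apply/val_inj/permP=> p; rewrite /= !permE /sperm_fun tpermC. Qed.

Lemma sbarC n (i j : 'I_n) : sbar i j = sbar j i.
Proof.
by apply/val_inj/permP=> p; rewrite /= !permE /sperm_fun /= tpermC orbC.
Qed.

Section LinearExtension.
Variables (K : comNzRingType) (n : nat) (V : lmodType K) (G : 'X_{1..n} -> V).
Implicit Types (f g : {mpoly K[n]}).

(** The linear map with value [G m] on the monomial ['X_[m]]; the evaluation of
    polynomials at commuting elements of an algebra is of this form. *)
Definition lin_ext f : V := \sum_(m <- msupp f) f@_m *: G m.

Lemma lin_extE f d : (msize f <= d)%N ->
  lin_ext f = \sum_(m : 'X_{1..n < d}) f@_m *: G m.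
Proof.
move=> fd; rewrite /lin_ext (big_mksub 'X_{1..n < d}) ?msupp_uniq //=.
  rewrite big_rmcond //= => m /memN_msupp_eq0 ->; exact: scale0r.
by move=> m /msize_mdeg_lt /leq_trans; apply.
Qed.

Lemma lin_ext_linear r f g : lin_ext (r *: f + g) = r *: lin_ext f + lin_ext g.
Proof.
pose d := maxn (msize (r *: f + g)) (maxn (msize f) (msize g)).
rewrite !(@lin_extE _ d) ?leq_max ?leqnn ?orbT // scaler_sumr -big_split /=.
by apply: eq_bigr => m _; rewrite mcoeffD mcoeffZ scalerDl scalerA.
Qed.

Lemma lin_extX m : lin_ext 'X_[m] = G m.
Proof. by rewrite /lin_ext msuppX big_seq1 mcoeffX eqxx scale1r. Qed.

Lemma lin_ext0 : lin_ext 0 = 0.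
Proof. by rewrite /lin_ext msupp0 big_nil. Qed.

Lemma lin_extD f g : lin_ext (f + g) = lin_ext f + lin_ext g.
Proof. by rewrite -[f in LHS]scale1r lin_ext_linear scale1r. Qed.

Lemma lin_extC r : lin_ext r%:MP = r *: G 0%MM.
Proof.
have -> : r%:MP = r *: 'X_[0] + 0 :> {mpoly K[n]}.
  by rewrite mpolyX0 -mul_mpolyC mulr1 addr0.
by rewrite lin_ext_linear lin_extX lin_ext0 addr0.
Qed.

(** For [G] the evaluation of monomials at commuting elements and [phi] the
    left multiplication by the [j]-th of them, this makes evaluation compatible
    with multiplication by ['X_j], although the target is noncommutative. *)
Lemma lin_extXM (phi : V -> V) j f :
    (forall r a b, phi (r *: a + b) = r *: phi a + phi b) ->
    (forall m, G (U_(j) + m)%MM = phi (G m)) ->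
  lin_ext ('X_j * f) = phi (lin_ext f).
Proof.
move=> philin GX; elim/mpolyind: f => [|r m f _ _ IH].
  have phi0 : phi 0 = 0.
    by have := philin (-1) 0 0; rewrite scaler0 addr0 scaleN1r addNr.
  by rewrite mulr0 lin_ext0 phi0.
rewrite mulrDr -scalerAr -mpolyXD !lin_ext_linear IH philin !lin_extX.
by rewrite GX.
Qed.

End LinearExtension.

(** Only the [x k] commute, so the factor [x j] has to be pulled to the front of
    the ordered product by hand. *)
Lemma prod_powers_mul (A : pzRingType) n (x : 'I_n -> A) j (m : 'X_{1..n}) :
    (forall i k, x i * x k = x k * x i) ->
  \prod_(k < n) x k ^+ (U_(j) + m)%MM k = x j * \prod_(k < n) x k ^+ m k.
Proof.
move=> xC; move: (mem_index_enum j) (index_enum_uniq 'I_n).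
elim: (index_enum _) => // k r IH; rewrite inE !big_cons mnmDE mnm1E /=.
case/orP=> [/eqP<-|jr] /andP[kr rU].
  rewrite eqxx exprS -mulrA; congr (_ * (_ * _)); apply: eq_big_seq => l lr.
  by rewrite mnmDE mnm1E; case: eqVneq lr kr => // -> ->.
rewrite IH //; have [jk|_] := eqVneq j k; first by rewrite jk (negbTE kr) in jr.
by rewrite add0n mulrA (mulrA (x j)); congr (_ * _); apply/esym/commrX.
Qed.

(** * Divided differences *)

(** If [D] and [a] are the quotients by [d] of [f - g] and [(X - X') g], then
    [X D + a] is the one of [X f - X' g]. With [g = f^s] and [X' = X^s] this is
    the Leibniz rule of a divided difference. *)
Lemma quotient_twisted_leibniz (R : comPzRingType) (X X' d D a f g : R) :
    D * d = f - g -> a * d = (X - X') * g ->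
  (X * D + a) * d = X * f - X' * g.
Proof.
by move=> Df ag; rewrite mulrDl ag -mulrA Df mulrBr mulrBl addrA subrK.
Qed.

Section ExactQuotients.
Variables (K : idomainType) (n : nat).
Implicit Types (p q d : {mpoly K[n]}) (i k : 'I_n).

Lemma exquo_eq p q d : d != 0 -> q * d = p -> exquo p d = q.
Proof.
move=> d0 qd; apply: classical_sets.xget_unique => //= q' q'd.
by apply: (mulIf d0); rewrite q'd.
Qed.

Lemma mpolyXB_neq0 i k : k != i -> 'X_i - 'X_k != 0 :> {mpoly K[n]}.
Proof.
move=> ki; apply/eqP=> /(congr1 (mcoeff U_(i))); apply/eqP.
by rewrite mcoeffB !mcoeffX eqxx eq_mnm1 (negbTE ki) subr0 mcoeff0 oner_eq0.
Qed.

Lemma mpolyXD_neq0 i k : k != i -> 'X_i + 'X_k != 0 :> {mpoly K[n]}.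
Proof.
move=> ki; apply/eqP=> /(congr1 (mcoeff U_(i))); apply/eqP.
by rewrite mcoeffD !mcoeffX eqxx eq_mnm1 (negbTE ki) addr0 mcoeff0 oner_eq0.
Qed.

Lemma mpoly2X_neq0 i : 2%:R != 0 :> K -> 2%:R * 'X_i != 0 :> {mpoly K[n]}.
Proof.
move=> K2; apply/eqP=> /(congr1 (mcoeff U_(i))); apply/eqP.
by rewrite mulr_natl mcoeffMn mcoeffX eqxx mcoeff0.
Qed.

End ExactQuotients.

(** * The commutator of y_i with a polynomial *)

Section DunklOperator.
Variables (K : comNzRingType) (n : nat) (A : pzRingType).
Variables (t u v : K) (cst : K -> A) (x y c e : 'I_n -> A) (w : W n -> A).
Variable pol : {mpoly K[n]} -> A.
Implicit Types (i j k l : 'I_n) (f g : {mpoly K[n]}) (a b : A) (sg : W n).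

Hypothesis cst_comm : forall (r : K) a, a * cst r = cst r * a.
Hypothesis w_x : forall sg j, w sg * x j = wact x sg j * w sg.
Hypothesis e_x : forall i j, e i * x j = x j * e i.
Hypothesis c_x : forall i j,
  c i * x j = if i == j then - (x j * c i) else x j * c i.
Hypothesis cc_anti : forall i j, i != j -> c i * c j = - (c j * c i).
Hypothesis y_x : forall i j, i != j -> y i * x j = x j * y i
  + (cst u * ((1 + c i * c j) * (1 + e j * e i) * w (s_ i j))
     - cst u * ((1 - c i * c j) * (1 - e j * e i) * w (sbar i j))).
Hypothesis y_x_diag : forall i, y i * x i = x i * y i
  + (cst t * (c i * e i)
     - cst u * (\sum_(k < n | k != i)
         (1 + c k * c i) * (1 + e k * e i) * w (s_ k i))
     - cst u * (\sum_(k < n | k != i)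
         (1 - c k * c i) * (1 - e k * e i) * w (sbar k i))
     - cst v * w (tau i)).
Hypothesis polD : forall f g, pol (f + g) = pol f + pol g.
Hypothesis polC : forall r, pol r%:MP = cst r.
Hypothesis polXM : forall j f, pol ('X_j * f) = x j * pol f.

Lemma pol0 : pol 0 = 0.
Proof. by apply: (addrI (pol 0)); rewrite -polD !addr0. Qed.

Lemma polN f : pol (- f) = - pol f.
Proof. by apply: (addrI (pol f)); rewrite -polD !subrr pol0. Qed.

Lemma pol_wactM sg j f :
  pol (wact (fun l => 'X_l) sg j * f) = wact x sg j * pol f.
Proof. by rewrite /wact; case: ifP => _; rewrite ?mulNr ?polN polXM. Qed.

(** An element that carries the [sg]-twisted variables to the [sg']-twisted
    ones carries all polynomials likewise. Every rule for moving a polynomial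
    across [w], [e] or [c] is an instance. *)
Lemma intertwine_pol a sg sg' f :
    (forall j, a * wact x sg j = wact x sg' j * a) ->
  a * pol (polact f sg) = pol (polact f sg') * a.
Proof.
move=> ax; elim/mpoly_generators_ind: f => [r|f g IHf IHg|j f IH].
- by rewrite !polactC polC cst_comm.
- by rewrite !polactD !polD mulrDr mulrDl IHf IHg.
- by rewrite !polactXM !pol_wactM mulrA ax -!mulrA IH.
Qed.

Lemma w_pol sg f : w sg * pol f = pol (polact f sg) * w sg.
Proof.
rewrite -[f in LHS]polact1; apply: intertwine_pol => j.
by rewrite wact1 w_x.
Qed.

Lemma e_pol i f : e i * pol f = pol f * e i.
Proof.
by rewrite -[f]polact1; apply: intertwine_pol => j; rewrite wact1 e_x.
Qed.

Lemma ee_pol k i f : e k * e i * pol f = pol f * (e k * e i).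
Proof. by rewrite -mulrA e_pol mulrA e_pol -mulrA. Qed.

Lemma cc_x k i j : k != i ->
  c k * c i * x j = (if (j == k) || (j == i) then - x j else x j) * (c k * c i).
Proof.
move=> ki; rewrite -mulrA c_x !(eq_sym j); case: (eqVneq i j) => [<-|_].
  by rewrite orbT mulrN mulrA c_x (negbTE ki) -mulrA mulNr.
by rewrite orbF mulrA c_x; case: ifP => _; rewrite ?mulNr -mulrA.
Qed.

(** The sign changes that [c_k c_i] causes on [x_k] and [x_i] are the difference
    between [s_ki] and [sbar_ki]. *)
Lemma cc_pol_s k i f : k != i ->
  c k * c i * pol (polact f (s_ k i)) = pol (polact f (sbar k i)) * (c k * c i).
Proof.
move=> ki; apply: intertwine_pol => j; rewrite wact_s wact_sbar cc_x //.
case: tpermP => [->|->|/eqP/negbTE-> /eqP/negbTE->];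
  by rewrite ?eqxx ?orbT /=.
Qed.

Lemma cc_pol_sbar k i f : k != i ->
  c k * c i * pol (polact f (sbar k i)) = pol (polact f (s_ k i)) * (c k * c i).
Proof.
move=> ki; apply: intertwine_pol => j; rewrite wact_s wact_sbar.
case: tpermP => [->|->|/eqP jk /eqP ji]; rewrite ?eqxx ?orbT /=.
- by rewrite mulrN cc_x // eqxx orbT mulNr opprK.
- by rewrite mulrN cc_x // eqxx mulNr opprK.
- by rewrite (negbTE jk) (negbTE ji) cc_x // (negbTE jk) (negbTE ji).
Qed.

(** The contributions of [s_ki] and [sbar_ki] to the Dunkl operator, where [f]
    and [g] stand for the divided differences by [x_i - x_k] and [x_i + x_k].
    The same two polynomials enter both contributions. *)
Definition sterm i k f g : A :=
  (pol f + pol g * (c k * c i)) * ((1 + e k * e i) * w (s_ k i)).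

Definition sbarterm i k f g : A :=
  (pol g - pol f * (c k * c i)) * ((1 - e k * e i) * w (sbar k i)).

Lemma stermD i k f f' g g' :
  sterm i k (f + f') (g + g') = sterm i k f g + sterm i k f' g'.
Proof. by rewrite /sterm !polD (mulrDl _ _ (c k * c i)) addrACA mulrDl. Qed.

Lemma sbartermD i k f f' g g' :
  sbarterm i k (f + f') (g + g') = sbarterm i k f g + sbarterm i k f' g'.
Proof. by rewrite /sbarterm !polD (mulrDl _ _ (c k * c i)) opprD addrACA mulrDl. Qed.

Lemma sterm_xM i j k f g :
  x j * sterm i k f g = sterm i k ('X_j * f) ('X_j * g).
Proof. by rewrite /sterm !polXM mulrA mulrDr -!mulrA. Qed.

Lemma sbarterm_xM i j k f g :
  x j * sbarterm i k f g = sbarterm i k ('X_j * f) ('X_j * g).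
Proof. by rewrite /sbarterm !polXM mulrA mulrBr -!mulrA. Qed.

Lemma sterm0 i k : sterm i k 0 0 = 0.
Proof. by rewrite /sterm pol0 mul0r addr0 mul0r. Qed.

Lemma sbarterm0 i k : sbarterm i k 0 0 = 0.
Proof. by rewrite /sbarterm pol0 mul0r subr0 mul0r. Qed.

Lemma stermN i k f g : sterm i k (- f) (- g) = - sterm i k f g.
Proof. by apply: (addrI (sterm i k f g)); rewrite -stermD !subrr sterm0. Qed.

Lemma sbartermN i k f g : sbarterm i k (- f) (- g) = - sbarterm i k f g.
Proof.
by apply: (addrI (sbarterm i k f g)); rewrite -sbartermD !subrr sbarterm0.
Qed.

(** Once [f] has crossed the group and Clifford factors, it becomes a
    value of [sterm] or [sbarterm]; this and the next three lemmas treat the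
    four products that occur in [[y_i, x_j] f]. *)
Lemma es_pol i k f :
  (1 + e k * e i) * w (s_ k i) * pol f = sterm i k (polact f (s_ k i)) 0.
Proof.
rewrite /sterm pol0 mul0r addr0 -mulrA w_pol 2!mulrA; congr (_ * _).
by rewrite mulrDl mulrDr mul1r mulr1 ee_pol.
Qed.

Lemma cces_pol i k f : k != i ->
  c k * c i * ((1 + e k * e i) * w (s_ k i) * pol f)
  = sterm i k 0 (polact f (sbar k i)).
Proof.
move=> ki; rewrite es_pol /sterm pol0 mul0r addr0 add0r.
by rewrite (mulrA (c k * c i)) cc_pol_s.
Qed.

Lemma esbar_pol i k f :
  (1 - e k * e i) * w (sbar k i) * pol f = sbarterm i k 0 (polact f (sbar k i)).
Proof.
rewrite /sbarterm pol0 mul0r subr0 -mulrA w_pol 2!mulrA; congr (_ * _).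
by rewrite mulrBl mulrBr mul1r mulr1 ee_pol.
Qed.

Lemma ccesbar_pol i k f : k != i ->
  c k * c i * ((1 - e k * e i) * w (sbar k i) * pol f)
  = - sbarterm i k (polact f (s_ k i)) 0.
Proof.
move=> ki; rewrite esbar_pol /sbarterm pol0 mul0r subr0 sub0r.
by rewrite (mulrA (c k * c i)) cc_pol_sbar // mulNr opprK.
Qed.

(** The Dunkl operator with arbitrary polynomials in place of the divided
    differences. The parts for [t] and [v] use the same quotient in the final
    formula; they are kept apart because [x_i] anticommutes with [c_i e_i] but
    commutes with polynomials, so that the two parts change differently in
    [dunkl_sum_xM] and [y_x_pol]. *)
Definition dunkl_sum i (ft fv : {mpoly K[n]}) (p q : 'I_n -> {mpoly K[n]}) : A :=
  cst t * (c i * e i) * pol ft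
  - cst u * (\sum_(k < n | k != i) sterm i k (p k) (q k))
  - cst u * (\sum_(k < n | k != i) sbarterm i k (p k) (q k))
  - cst v * (pol fv * w (tau i)).

Lemma dunkl_sumD i ft ft' fv fv' p p' q q' :
  dunkl_sum i (ft + ft') (fv + fv')
    (fun k => p k + p' k) (fun k => q k + q' k)
  = dunkl_sum i ft fv p q + dunkl_sum i ft' fv' p' q'.
Proof.
rewrite /dunkl_sum (eq_bigr _ (fun k _ => stermD i k _ _ _ _)).
rewrite (eq_bigr _ (fun k _ => sbartermD i k _ _ _ _)) !big_split /=.
rewrite !polD [(_ + _) * w _]mulrDl !mulrDr.
suff subACA (p1 p2 p3 p4 q1 q2 q3 q4 : A) :
    p1 + q1 - (p2 + q2) - (p3 + q3) - (p4 + q4)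
    = (p1 - p2 - p3 - p4) + (q1 - q2 - q3 - q4) by exact: subACA.
by rewrite !opprD (addrACA p1) (addrACA (p1 - p2)) (addrACA (p1 - p2 - p3)).
Qed.

Lemma dunkl_sum_xM i j ft fv p q :
  x j * dunkl_sum i ft fv p q
  = dunkl_sum i (if i == j then - ('X_j * ft) else 'X_j * ft) ('X_j * fv)
      (fun k => 'X_j * p k) (fun k => 'X_j * q k).
Proof.
have xcst r a : x j * (cst r * a) = cst r * (x j * a).
  by rewrite mulrA cst_comm mulrA.
have xce a : x j * (c i * e i * a)
    = c i * e i * (if i == j then - (x j * a) else x j * a).
  have -> : c i * e i * (if i == j then - (x j * a) else x j * a)
      = (if i == j then - (c i * x j) else c i * x j) * (e i * a).
    by case: ifP => _; rewrite ?mulrN ?mulNr -!mulrA (mulrA (e i)) e_x !mulrA.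
  by rewrite c_x; case: (i == j); rewrite ?opprK !mulrA.
rewrite /dunkl_sum !(mulrBr (x j)) -!(mulrA (cst t)) !xcst xce.
rewrite (mulrA (x j) (pol fv)).
rewrite -!polXM -polN -fun_if !mulr_sumr.
by congr (_ - _ - _ - _); apply: eq_bigr => k _; rewrite ?sterm_xM ?sbarterm_xM.
Qed.

(** The values [0], [1] and [-1] of the quotients of [x_j - x_j^s] by
    [x_i - x_k], of [x_j - x_j^sbar] by [x_i + x_k] and of [x_j - x_j^tau] by
    [2 x_i] appear as multiples by booleans. They make one formula out of the
    relations for [j = i], where all [k] contribute, and for [j != i], where
    only [k = j] does. *)
Lemma y_x_pol i j f :
  y i * x j * pol f = x j * (y i * pol f)
    + dunkl_sum i (f *+ (i == j)) (polact f (tau i) *+ (i == j))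
        (fun k => polact f (s_ k i) *+ (i == j) - polact f (s_ k i) *+ (k == j))
        (fun k => polact f (sbar k i) *+ (i == j)
                  + polact f (sbar k i) *+ (k == j)).
Proof.
have mulA4 (p q r s : A) : p * q * r * s = p * (q * r * s) by rewrite !mulrA.
have [<-|ij] := eqVneq i j.
  rewrite y_x_diag mulrDl -mulrA; congr (_ + _).
  rewrite /dunkl_sum !mulrBl -!(mulrA (cst _)) w_pol !mulr_suml.
  congr (_ - _ * _ - _ * _ - _); apply: eq_bigr => k ki;
    rewrite (negbTE ki) mulr1n mulr0n subr0 addr0 mulA4.
  - rewrite mulrDl mul1r cces_pol // es_pol -stermD.
    by rewrite addr0 add0r.
  - rewrite mulrBl mul1r ccesbar_pol // esbar_pol opprK.
    by rewrite -sbartermD addr0 add0r.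
have ji : j != i by rewrite eq_sym.
rewrite y_x // mulrDl -mulrA; congr (_ + _).
rewrite /dunkl_sum pol0 mulr0 mul0r mulr0 subr0 sub0r.
have only (F : 'I_n -> A) :
    (forall k, k != j -> F k = 0) -> \sum_(k < n | k != i) F k = F j.
  by move=> F0; rewrite (bigD1 j) //= big1 ?addr0 // => k /andP[_ /F0].
rewrite !only ?eqxx => [|k /negbTE->|k /negbTE->]; last 2 first.
- by rewrite !mulr0n subr0 addr0 sbarterm0.
- by rewrite !mulr0n subr0 addr0 sterm0.
rewrite !mulr0n !mulr1n !sub0r !add0r cc_anti // opprK s_C sbarC.
rewrite mulrBl -2!(mulrA (cst u)); congr (_ - _).
- rewrite -(mulrN (cst u)); congr (_ * _); rewrite mulA4 mulrBl mul1r.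
  by rewrite cces_pol // es_pol -!stermN -stermD !(addr0, add0r, oppr0, opprK).
- congr (_ * _); rewrite mulA4 mulrDl mul1r.
  rewrite ccesbar_pol // esbar_pol -sbartermN -sbartermD.
  by rewrite !(addr0, add0r, oppr0).
Qed.

Lemma dunkl_sum_eq i ft ft' fv fv' p p' q q' : ft = ft' -> fv = fv' ->
    (forall k, k != i -> p k = p' k) -> (forall k, k != i -> q k = q' k) ->
  dunkl_sum i ft fv p q = dunkl_sum i ft' fv' p' q'.
Proof.
move=> -> -> pp' qq'; rewrite /dunkl_sum.
have -> : \sum_(k < n | k != i) sterm i k (p k) (q k)
    = \sum_(k < n | k != i) sterm i k (p' k) (q' k).
  by apply: eq_bigr => k ki; rewrite pp' ?qq'.
have -> : \sum_(k < n | k != i) sbarterm i k (p k) (q k)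
    = \sum_(k < n | k != i) sbarterm i k (p' k) (q' k).
  by apply: eq_bigr => k ki; rewrite pp' ?qq'.
by [].
Qed.

Definition dunkl_quotients i f d (p q : 'I_n -> {mpoly K[n]}) : Prop :=
  [/\ d * (2%:R * 'X_i) = f - polact f (tau i),
      forall k, k != i -> p k * ('X_i - 'X_k) = f - polact f (s_ k i)
    & forall k, k != i -> q k * ('X_i + 'X_k) = f - polact f (sbar k i)].

Lemma dunkl_quotientsXM i j f d p q : dunkl_quotients i f d p q ->
  dunkl_quotients i ('X_j * f) ('X_j * d + polact f (tau i) *+ (i == j))
    (fun k => 'X_j * p k
       + (polact f (s_ k i) *+ (i == j) - polact f (s_ k i) *+ (k == j)))
    (fun k => 'X_j * q k
       + (polact f (sbar k i) *+ (i == j) + polact f (sbar k i) *+ (k == j))).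
Proof.
case=> df pf qf; split=> [|k ki|k ki]; rewrite polactXM;
  apply: quotient_twisted_leibniz; rewrite ?df ?pf ?qf //.
- rewrite wact_tau eq_sym; case: eqVneq => [<-|_].
    by rewrite mulr1n opprK mulrC mulr_natl mulr2n.
  by rewrite mulr0n mul0r subrr mul0r.
- rewrite wact_s; case: tpermP => [->|->|/eqP jk /eqP ji].
  + by rewrite eqxx eq_sym (negbTE ki) sub0r mulNr -mulrN opprB mulrC.
  + by rewrite eqxx (negbTE ki) subr0 mulrC.
  + by rewrite !(eq_sym _ j) (negbTE jk) (negbTE ji) !subrr !mul0r.
- rewrite wact_sbar; case: tpermP => [->|->|/eqP jk /eqP ji].
  + by rewrite !eqxx eq_sym (negbTE ki) add0r opprK addrC mulrC.
  + by rewrite !eqxx (negbTE ki) orbT addr0 opprK mulrC.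
  + by rewrite !(eq_sym _ j) (negbTE jk) (negbTE ji) addr0 subrr !mul0r.
Qed.


Definition exact_dunkl_sum i f : A :=
  let Dtau := exquo (f - polact f (tau i)) (2%:R * 'X_i) in
  dunkl_sum i Dtau Dtau
    (fun k => exquo (f - polact f (s_ k i)) ('X_i - 'X_k))
    (fun k => exquo (f - polact f (sbar k i)) ('X_i + 'X_k)).

(** The quotients are quantified existentially, so that the induction produces
    them; their uniqueness, which needs a domain, comes later. *)
Lemma y_pol i f : exists d p q,
  dunkl_quotients i f d p q /\ y i * pol f = pol f * y i + dunkl_sum i d d p q.
Proof.
elim/mpoly_generators_ind: f => [r|f g [d [p [q [[df pf qf] yf]]]]
    [d' [p' [q' [[df' pf' qf'] yg]]]]|j f [d [p [q [df yf]]]]].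
- exists 0, (fun=> 0), (fun=> 0); split.
    by split=> [|k _|k _]; rewrite polactC subrr mul0r.
  rewrite polC cst_comm /dunkl_sum pol0 mulr0 mul0r mulr0.
  rewrite !big1 => [|k _|k _]; rewrite ?sterm0 ?sbarterm0 //.
  by rewrite !mulr0 !subr0 addr0.
- exists (d + d'), (fun k => p k + p' k), (fun k => q k + q' k); split.
    split=> [|k ki|k ki]; rewrite polactD opprD addrACA mulrDl.
    + by rewrite df df'.
    + by rewrite pf ?pf'.
    + by rewrite qf ?qf'.
  by rewrite dunkl_sumD polD mulrDr mulrDl yf yg addrACA.
- do 3!eexists; split; first exact: dunkl_quotientsXM df.
  rewrite polXM mulrA y_x_pol yf mulrDr -!mulrA -addrA; congr (_ + _).
  rewrite dunkl_sum_xM -dunkl_sumD.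
  congr (dunkl_sum _ _ _ _).
  (* For j = i the t-part reads - x_i d + f on one side and x_i d + f^tau on the
     other; they agree since f - f^tau = 2 x_i d. *)
  case: df => df _ _; have [ij|_] := eqVneq i j; last by [].
  rewrite mulr1n -ij -[polact f _](subKr f) -df mulr_natl mulrnAr mulr2n.
  by rewrite (mulrC d) opprD addrCA (addrA ('X_i * d)) subrr add0r addrC.
Qed.

End DunklOperator.

Section ExactDunklSum.
Variables (K : idomainType) (n : nat) (A : pzRingType).
Variables (t u v : K) (cst : K -> A) (c e : 'I_n -> A) (w : W n -> A).
Variable pol : {mpoly K[n]} -> A.
Hypothesis K2 : 2%:R != 0 :> K.

(** Divisors are nonzero polynomials over a domain, so a quotient that exists is
    the exact quotient. *)
Lemma dunkl_sum_exquo i f d p q : dunkl_quotients i f d p q ->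
  dunkl_sum t u v cst c e w pol i d d p q
  = exact_dunkl_sum t u v cst c e w pol i f.
Proof.
case=> dE pE qE; have dD := exquo_eq (mpoly2X_neq0 i K2) dE.
apply: dunkl_sum_eq.
- exact: esym dD.
- exact: esym dD.
- by move=> k ki; exact: esym (exquo_eq (mpolyXB_neq0 K ki) (pE k ki)).
- by move=> k ki; exact: esym (exquo_eq (mpolyXD_neq0 K ki) (qE k ki)).
Qed.

End ExactDunklSum.

(** * The commutator formula in the presented algebra *)

(** Of the free algebra on the generators, only the centrality of its scalars
    enters, so that [F] stands for any left algebra with this property. *)
Section QuotientAlgebra.
Variables (K : idomainType) (n : nat) (t u v : K) (F : lalgType K).
Variables (x y c e : 'I_n -> F) (w : W n -> F).
Hypothesis F_scaleAr : forall (r : K) (a b : F), a * (r *: b) = r *: (a * b).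
Local Notation rel := (Hcc_relations t u v x y c e w).
Local Notation A := (algquot rel).
Local Notation pi := (alg_pi rel).
Local Notation cst r := (r *: (1 : A)).
Implicit Types (i j k : 'I_n).

Lemma quot_scaleAl (r : K) (a b : A) : r *: a * b = r *: (a * b).
Proof.
elim/alg_pi_ind: a => a; elim/alg_pi_ind: b => b.
by rewrite -alg_piZ -!alg_piM -alg_piZ scalerAl.
Qed.

Lemma quot_scaleAr (r : K) (a b : A) : a * (r *: b) = r *: (a * b).
Proof.
elim/alg_pi_ind: a => a; elim/alg_pi_ind: b => b.
by rewrite -alg_piZ -!alg_piM -alg_piZ F_scaleAr.
Qed.

Lemma quot_cst_comm (r : K) (a : A) : a * cst r = cst r * a.
Proof. by rewrite quot_scaleAr quot_scaleAl mulr1 mul1r. Qed.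

Lemma quot_cst (r : K) (a : A) : r *: a = cst r * a.
Proof. by rewrite quot_scaleAl mul1r. Qed.

Lemma pi_wact (h : 'I_n -> F) sg j :
  pi (wact h sg j) = wact (fun l => pi (h l)) sg j.
Proof. by rewrite /wact; case: ifP => // _; rewrite alg_piN. Qed.

Lemma pi_sum (I : Type) (r : seq I) (P : pred I) (E : I -> F) :
  pi (\sum_(l <- r | P l) E l) = \sum_(l <- r | P l) pi (E l).
Proof. exact: (big_morph _ (@alg_piD _ _ rel) (alg_pi0 rel)). Qed.

Lemma quot_cc i j : i != j -> pi (c i) * pi (c j) = - (pi (c j) * pi (c i)).
Proof.
by move=> ij; rewrite -!alg_piM -alg_piN; exact/alg_pi_rel/H_smash/sm_cC.
Qed.

Lemma quot_wx sg j :
  pi (w sg) * pi (x j) = wact (fun l => pi (x l)) sg j * pi (w sg).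
Proof. by rewrite -pi_wact -!alg_piM; exact/alg_pi_rel/H_wx. Qed.

Lemma quot_xx i j : pi (x i) * pi (x j) = pi (x j) * pi (x i).
Proof. by rewrite -!alg_piM; exact/alg_pi_rel/H_xx. Qed.

Lemma quot_ex i j : pi (e i) * pi (x j) = pi (x j) * pi (e i).
Proof. by rewrite -!alg_piM; exact/alg_pi_rel/H_ex. Qed.

Lemma quot_cx i j : pi (c i) * pi (x j)
  = if i == j then - (pi (x j) * pi (c i)) else pi (x j) * pi (c i).
Proof.
rewrite -!alg_piM (alg_pi_rel (H_cx t u v x y c e w i j)).
by case: (i == j); rewrite ?expr1 ?expr0 ?mulN1r ?mul1r ?alg_piN.
Qed.

Lemma quot_yx i j : i != j -> pi (y i) * pi (x j) = pi (x j) * pi (y i)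
  + (cst u * ((1 + pi (c i) * pi (c j)) * (1 + pi (e j) * pi (e i))
       * pi (w (s_ i j)))
     - cst u * ((1 - pi (c i) * pi (c j)) * (1 - pi (e j) * pi (e i))
       * pi (w (sbar i j)))).
Proof.
move=> ij; apply/eqP; rewrite addrC -subr_eq -!quot_cst; apply/eqP.
have := alg_pi_rel (H_yx t u v x y c e w ij).
by rewrite !(alg_piB, alg_piD, alg_piM, alg_piZ).
Qed.

Lemma quot_yx_diag i : pi (y i) * pi (x i) = pi (x i) * pi (y i)
  + (cst t * (pi (c i) * pi (e i))
     - cst u * (\sum_(k < n | k != i)
         (1 + pi (c k) * pi (c i)) * (1 + pi (e k) * pi (e i)) * pi (w (s_ k i)))
     - cst u * (\sum_(k < n | k != i)
         (1 - pi (c k) * pi (c i)) * (1 - pi (e k) * pi (e i)) * pi (w (sbar k i)))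
     - cst v * pi (w (tau i))).
Proof.
apply/eqP; rewrite addrC -subr_eq -!quot_cst; apply/eqP.
have := alg_pi_rel (H_yx_diag t u v x y c e w i).
rewrite !(alg_piB, alg_piD, alg_piM, alg_piZ, pi_sum) => ->.
by congr (_ - _ *: _ - _ *: _ - _); apply: eq_bigr => k _;
  rewrite !(alg_piB, alg_piD, alg_piM).
Qed.

Local Notation X := (fun l => pi (x l)).
Local Notation polA := (lin_ext (fun a : 'X_{1..n} => \prod_(k < n) X k ^+ a k : A)).

Lemma quot_y_pol i (f : {mpoly K[n]}) : 2%:R != 0 :> K ->
  pi (y i) * polA f = polA f * pi (y i)
    + exact_dunkl_sum t u v (fun r => cst r) (fun l => pi (c l))
        (fun l => pi (e l)) (fun sg => pi (w sg)) polA i f.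
Proof.
move=> K2.
suff [d [p [q [/(dunkl_sum_exquo _ _ _ _ _ _ _ _ K2) <- ->]]]] : exists d p q,
    dunkl_quotients i f d p q /\ pi (y i) * polA f = polA f * pi (y i)
    + dunkl_sum t u v (fun r => cst r) (fun l => pi (c l)) (fun l => pi (e l))
        (fun sg => pi (w sg)) polA i d d p q by [].
apply: (@y_pol _ _ _ _ _ _ _ X (fun l => pi (y l))).
- exact: quot_cst_comm.
- exact: quot_wx.
- exact: quot_ex.
- exact: quot_cx.
- exact: quot_cc.
- exact: quot_yx.
- exact: quot_yx_diag.
- exact: lin_extD.
- by move=> r; rewrite lin_extC big1 // => k _; rewrite mnm0E expr0.
- move=> j g; apply: (lin_extXM (phi := fun a => X j * a)) => [r a b|m].
    by rewrite mulrDr quot_scaleAr.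
  exact/prod_powers_mul/quot_xx.
Qed.

End QuotientAlgebra.

Lemma Hcc_y_pol (K : idomainType) n (t u v : K) (i : 'I_n) f :
  2%:R != 0 :> K ->
  hy t u v i * pol t u v f = pol t u v f * hy t u v i
    + exact_dunkl_sum t u v (hcst t u v) (hc t u v) (he t u v) (@hw K n t u v)
        (pol t u v) i f.
Proof. exact: (quot_y_pol t u v _ _ _ _ _ (@freealg_scaleAr K _) i f). Qed.

(** * Passing to the induced module *)

Section InducedVectors.
Variables (H S : pzRingType) (emb : S -> H) (M : zmodType) (act : S -> M -> M).
Local Notation tens := (tens emb act).

Lemma tens0l m : tens 0 m = 0.
Proof. by apply: (addrI (tens 0 m)); rewrite -tensDl !addr0. Qed.

Lemma tensBl h h' m : tens (h - h') m = tens h m - tens h' m.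
Proof. by apply: (addIr (tens h' m)); rewrite -tensDl !subrK. Qed.

Lemma tens0r h : tens h 0 = 0.
Proof. by apply: (addrI (tens h 0)); rewrite -tensDr !addr0. Qed.

Lemma tens_suml (I : Type) (r : seq I) (P : pred I) (E : I -> H) m :
  tens (\sum_(l <- r | P l) E l) m = \sum_(l <- r | P l) tens (E l) m.
Proof. exact: (big_morph (tens^~ m) (fun h h' => tensDl _ _ h h' m) (tens0l m)). Qed.

Lemma left_actionB a b m : left_action act -> act (a - b) m = act a m - act b m.
Proof.
by case=> _ _ actD _; apply: (addIr (act b m)); rewrite -actD !subrK.
Qed.

End InducedVectors.

(** [S -> H] is the inclusion of the subalgebra from which the module is induced,
    with [yS] acting by zero, and [Q] is the ring that acts on [M] before the
    extension to [S]; the letters [e] and [w] denote matching elements of [H],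
    [S] and [Q]. *)
Section InducedAction.
Variables (K : comNzRingType) (n : nat) (H S Q : pzRingType) (M : lmodType Q).
Variables (emb : S -> H) (act : S -> M -> M).
Variables (t u v : K) (cst : K -> H) (c e : 'I_n -> H) (w : W n -> H).
Variables (pol : {mpoly K[n]} -> H) (y : H) (i : 'I_n).
Variables (eS : 'I_n -> S) (wS : W n -> S) (yS : S).
Variables (eQ : 'I_n -> Q) (wQ : W n -> Q).
Local Notation tens := (tens emb act).

Hypothesis actP : left_action act.
Hypothesis act_e : forall k m, act (eS k) m = eQ k *: m.
Hypothesis act_w : forall sg m, act (wS sg) m = wQ sg *: m.
Hypothesis act_y : forall m, act yS m = 0.
Hypothesis emb_y : emb yS = y.
Hypothesis emb_w : forall sg, emb (wS sg) = w sg.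
Hypothesis emb_ew : forall k sg,
  emb ((1 + eS k * eS i) * wS sg) = (1 + e k * e i) * w sg.
Hypothesis emb_ewN : forall k sg,
  emb ((1 - eS k * eS i) * wS sg) = (1 - e k * e i) * w sg.

Lemma act_ew k sg m :
  act ((1 + eS k * eS i) * wS sg) m = ((1 + eQ k * eQ i) * wQ sg) *: m.
Proof.
have [act1 actM actD _] := actP.
by rewrite actM actD act1 actM !act_e act_w -scalerA scalerDl scale1r scalerA.
Qed.

Lemma act_ewN k sg m :
  act ((1 - eS k * eS i) * wS sg) m = ((1 - eQ k * eQ i) * wQ sg) *: m.
Proof.
have [act1 actM _ _] := actP.
rewrite actM left_actionB // act1 actM !act_e act_w -scalerA scalerBl scale1r.
by rewrite scalerA.
Qed.

Lemma y_tens f d p q m :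
    y * pol f = pol f * y + dunkl_sum t u v cst c e w pol i d d p q ->
  y *: tens (pol f) m =
    tens (cst t * (c i * e i) * pol d) m
    - cst u *: (\sum_(k < n | k != i)
        tens (pol (p k) + pol (q k) * (c k * c i))
          (((1 + eQ k * eQ i) * wQ (s_ k i)) *: m))
    - cst u *: (\sum_(k < n | k != i)
        tens (pol (q k) - pol (p k) * (c k * c i))
          (((1 - eQ k * eQ i) * wQ (sbar k i)) *: m))
    - cst v *: tens (pol d) (wQ (tau i) *: m).
Proof.
move=> yf; rewrite scale_tens yf tensDl -[in pol f * y]emb_y tens_act act_y.
have tens_cst r (E : 'I_n -> H) :
    tens (cst r * (\sum_(k < n | k != i) E k)) m
    = cst r *: (\sum_(k < n | k != i) tens (E k) m).
  by rewrite -(scale_tens emb act (cst r)) tens_suml.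
rewrite tens0r add0r /dunkl_sum !tensBl 2!tens_cst.
rewrite -(scale_tens emb act (cst v)) -emb_w tens_act act_w.
under eq_bigr => k _ do rewrite /sterm -emb_ew tens_act act_ew.
under [\sum_(k < n | k != i) tens (sbarterm _ _ _ _ _ _ _ _) _]eq_bigr => k _
  do rewrite /sbarterm -emb_ewN tens_act act_ewN.
by [].
Qed.

End InducedAction.

Theorem theorem3p15 (R : realType) (n : nat) (t u v : R[i])
    (M : lmodType (smash R[i] n)) (act : Hy n t u v -> M -> M)
    (act_ext : extends_by_zero act) (i : 'I_n) (f : {mpoly R[i][n]}) (m : M) :
  let y (k : 'I_n) := hy t u v k in
  let c (k : 'I_n) := hc t u v k in
  let e (k : 'I_n) := he t u v k in
  let P (g : {mpoly R[i][n]}) := pol t u v g in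
  let cst (a : R[i]) : Hcc n t u v := hcst t u v a in
  let eM (k : 'I_n) : smash R[i] n := se k in
  let wM (sg : W n) : smash R[i] n := sw sg in
  let D (k : 'I_n) := exquo (f - polact f (s_ k i)) ('X_i - 'X_k) in
  let Dbar (k : 'I_n) := exquo (f - polact f (sbar k i)) ('X_i + 'X_k) in
  let Dtau := exquo (f - polact f (tau i)) (2%:R * 'X_i) in
  y i *: tensM act (P f) m =
    tensM act (cst t * (c i * e i) * P Dtau) m
    - cst u *: \sum_(k < n | k != i)
        tensM act (P (D k) + P (Dbar k) * (c k * c i))
          (((1 + eM k * eM i) * wM (s_ k i)) *: m)
    - cst u *: \sum_(k < n | k != i)
        tensM act (P (Dbar k) - P (D k) * (c k * c i))
          (((1 - eM k * eM i) * wM (sbar k i)) *: m)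
    - cst v *: tensM act (P Dtau) (wM (tau i) *: m).
Proof.
move=> y c e P cst eM wM D Dbar Dtau; case: (act_ext) => actP act_gen.
have K2 : 2%:R != 0 :> R[i] by rewrite Num.Theory.pnatr_eq0.
(* The inclusion of the subalgebra preserves the ring operations by
   computation, hence the reflexivity proofs. *)
exact: (@y_tens R[i] n (Hcc n t u v) (Hy n t u v) (smash R[i] n) M
  (@Hy_val R[i] n t u v) act t u v cst c e (@hw R[i] n t u v) P (y i) i
  (ye t u v) (@yw R[i] n t u v) (yy t u v i) eM wM actP
  (fun k m' => let: And5 _ _ act_e _ _ := act_gen m' in act_e k)
  (fun sg m' => let: And5 _ _ _ act_w _ := act_gen m' in act_w sg)
  (fun m' => let: And5 _ _ _ _ act_y := act_gen m' in act_y i)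
  (erefl _) (fun=> erefl _) (fun _ _ => erefl _) (fun _ _ => erefl _)
  f Dtau D Dbar m (Hcc_y_pol t u v i f K2)).
Qed.
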